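(* Let $l_0\ge 1$. For any nonnegative, strictly concave function $g:\mathbb{R}_{\ge 0}\to\mathbb{R}$ and any $v_{\max}>1$, the function $$u(v)=\begin{cases} g(\max(1,v)), & v\le v_{\max},\\ \infty, & \text{otherwise}\end{cases}$$ is an $l_0$-sub-Gaussian uniform boundary with crossing probability at most $$l_0\inf_{\eta>1}\sum_{k=0}^{\lceil\log_\eta v_{\max}\rceil}\exp\left\{-\frac{2\left(g(\eta^{k+1})-g(\eta^k)\right)\left(\eta g(\eta^k)-g(\eta^{k+1})\right)}{\eta^k(\eta-1)^2}\right\}.$$
   Context: Sub-$\psi$ condition: let $(S_t)_{t=0}^\infty$, $(V_t)_{t=0}^\infty$ be real-valued processes adapted to a filtration $(\mathcal F_t)_{t=0}^\infty$ with $S_0=V_0=0$ and $V_t\ge 0$ for all $t$. For $\psi:[0,\lambda_{\max})\to\mathbb{R}$ and $l_0\in[1,\infty)$, $(S_t)$ is $l_0$-sub-$\psi$ with variance process $(V_t)$ if for each $\lambda\in[0,\lambda_{\max})$ there is a supermartingale $(L_t(\lambda))_{t=0}^\infty$ with respect to $(\mathcal F_t)$ with $\mathbb{E}L_0(\lambda)\le l_0$ and $\exp\{\lambda S_t-\psi(\lambda)V_t\}\le L_t(\lambda)$ a.s. for all $t$. Uniform boundary: $u$ (possibly taking the value $+\infty$) is an $l_0$-sub-$\psi$ uniform boundary with crossing probability at most $p$ if $\mathbb{P}(\exists t\ge 1: S_t\ge u(V_t))\le p$ for every pair $(S_t,V_t)$ such that $(S_t)$ is $l_0$-sub-$\psi$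 with variance process $(V_t)$. Sub-Gaussian means sub-$\psi$ with $\psi(\lambda)=\psi_N(\lambda)=\lambda^2/2$ on $[0,\infty)$. *)

(* Defs.v *)
From HB Require Import structures.
From mathcomp Require Import all_boot all_order all_algebra.
From mathcomp Require Import all_classical all_reals all_analysis.

Set Implicit Arguments.
Unset Strict Implicit.
Unset Printing Implicit Defensive.

Import Order.TTheory GRing.Theory Num.Theory.
Import numFieldNormedType.Exports.

Local Open Scope classical_set_scope.
Local Open Scope ring_scope.

Record filtration (d : measure_display) (T : measurableType d) := Filtration {
  filtration_sets :> nat -> set (set T);
  filtration_sigma_algebra : forall t, sigma_algebra setT (filtration_sets t);
  filtration_measurable : forall t, filtration_sets t `<=` measurable;
  filtration_nondecreasing : forall s t, (s <= t)%N ->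
    filtration_sets s `<=` filtration_sets t }.

(* g_sigma_algebraType G is T with the sigma-algebra <<s G >>, which is G itself
   whenever G is a sigma-algebra. *)
Definition measurable_wrt (d : measure_display) (T : measurableType d)
    (R : realType) (G : set (set T)) (X : T -> R) : Prop :=
  measurable_fun [set: g_sigma_algebraType G] (X : g_sigma_algebraType G -> R).

Definition adapted (d : measure_display) (T : measurableType d)
    (R : realType) (F : filtration T) (X : nat -> T -> R) : Prop :=
  forall t, measurable_wrt (F t) (X t).

(* Z is a version of E[X | G]. *)
Definition is_cond_expectation (d : measure_display) (T : measurableType d)
    (R : realType) (P : probability T R) (G : set (set T)) (X Z : T -> R) :
    Prop :=
  [/\ measurable_wrt G Z,
      P.-integrable setT (EFin \o Z) &
      forall A, G A ->
        (\int[P]_(w in A) (Z w)%:E = \int[P]_(w in A) (X w)%:E)%E].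

(* E[L_(t+1) | F_t] <= L_t a.s.; conditional expectations are a.s. unique, so
   it does not matter which version Z is taken. *)
Definition supermartingale (d : measure_display) (T : measurableType d)
    (R : realType) (P : probability T R) (F : filtration T)
    (L : nat -> T -> R) : Prop :=
  [/\ adapted F L,
      forall t, P.-integrable setT (EFin \o L t) &
      forall t, exists2 Z : T -> R,
        is_cond_expectation P (F t) (L t.+1) Z &
        {ae P, forall w, Z w <= L t w}].

(* psi is only used on [0, lambda_max[, where lambda_max may be +oo. *)
Definition sub_psi (d : measure_display) (T : measurableType d)
    (R : realType) (P : probability T R) (F : filtration T)
    (lambda_max : \bar R) (psi : R -> R) (l0 : R) (S V : nat -> T -> R) :
    Prop :=
  [/\ adapted F S /\ adapted F V,
      forall w, S 0%N w = 0 /\ V 0%N w = 0,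
      forall t w, 0 <= V t w &
      forall lambda : R, 0 <= lambda -> (lambda%:E < lambda_max)%E ->
        exists L : nat -> T -> R,
          [/\ supermartingale P F L,
              ('E_P[L 0%N] <= l0%:E)%E &
              forall t, {ae P, forall w,
                expR (lambda * S t w - psi lambda * V t w) <= L t w}]].

Definition crossing (d : measure_display) (T : measurableType d)
    (R : realType) (u : R -> \bar R) (S V : nat -> T -> R) : set T :=
  [set w | exists t, (1 <= t)%N /\ (u (V t w) <= (S t w)%:E)%E].

(* A probability is a function on all subsets of T that is only meaningful on
   the measurable ones, so "P(crossing) <= p" includes that the crossing is an
   event. *)
Definition uniform_boundary (R : realType) (lambda_max : \bar R)
    (psi : R -> R) (l0 : R) (u : R -> \bar R) (p : R) : Prop :=
  forall (d : measure_display) (T : measurableType d) (P : probability T R)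
         (F : filtration T) (S V : nat -> T -> R),
    sub_psi P F lambda_max psi l0 S V ->
    measurable (crossing u S V) /\ (P (crossing u S V) <= p%:E)%E.

Definition psi_N (R : realType) (lambda : R) : R := lambda ^+ 2 / 2.

Definition sub_gaussian_uniform_boundary (R : realType) (l0 : R)
    (u : R -> \bar R) (p : R) : Prop :=
  uniform_boundary +oo%E (@psi_N R) l0 u p.

Definition strictly_concave_on (R : realType) (D : set R) (g : R -> R) : Prop :=
  forall x y t : R, D x -> D y -> x != y -> 0 < t -> t < 1 ->
    t * g x + (1 - t) * g y < g (t * x + (1 - t) * y).

Definition truncated_boundary (R : realType) (g : R -> R) (v_max v : R) :
    \bar R :=
  if v <= v_max then (g (Num.max 1 v))%:E else +oo%E.

Definition crossing_sum (R : realType) (g : R -> R) (v_max eta : R) : R :=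
  (* ln v_max / ln eta > 0 when eta, v_max > 1, so absz loses nothing *)
  \sum_(0 <= k < `|Num.ceil (ln v_max / ln eta)|%N.+1)
    expR (- (2 * (g (eta ^+ k.+1) - g (eta ^+ k))
               * (eta * g (eta ^+ k) - g (eta ^+ k.+1))
             / (eta ^+ k * (eta - 1) ^+ 2))).

(* Main.v *)
(* Split the values 1 <= v <= v_max of V_t at the powers of eta. On
   [eta^k, eta^(k+1)] concavity puts g above its chord a + b v, so a crossing of
   the boundary there is a crossing of this line by (V_t, S_t); since b >= 0, this
   also covers v < 1 with k = 0. If S_t >= a + b V_t, then the exponential process
   at lambda = 2b is at least exp(2ab), so Ville's maximal inequality bounds the
   probability of ever crossing the line by l0 exp(-2ab), which is l0 times the
   k-th term of the sum. *)

Require Import Defs.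
From mathcomp Require Import all_boot all_order all_algebra.
From mathcomp Require Import all_classical all_reals all_analysis measurable_realfun.
From mathcomp Require Import ring lra.

Import Order.TTheory GRing.Theory Num.Theory.
Local Open Scope classical_set_scope.
Local Open Scope ring_scope.

(** * Adapted processes and almost sure comparison of integrals *)

Lemma measurable_filtrationE {d : measure_display} {T : measurableType d}
    (F : filtration T) (t : nat) :
  @measurable _ (g_sigma_algebraType (F t)) = F t.
Proof. exact: (sigma_algebra_id (filtration_sigma_algebra F t)). Qed.

Lemma adapted_preimage {d : measure_display} {T : measurableType d}
    {R : realType} {F : filtration T} {X : nat -> T -> R} (B : set R)
    (s t : nat) :
  adapted F X -> measurable B -> (s <= t)%N -> F t (X s @^-1` B).
Proof.
move=> aX mB st; apply: (filtration_nondecreasing st).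
by rewrite -measurable_filtrationE -[_ @^-1` _]setTI; exact: aX.
Qed.

Lemma adapted_measurable_fun {d : measure_display} {T : measurableType d}
    {R : realType} {F : filtration T} {X : nat -> T -> R} (t : nat) :
  adapted F X -> measurable_fun setT (X t).
Proof.
move=> aX _ B mB; rewrite setTI.
apply: (@filtration_measurable _ _ F t).
exact: adapted_preimage.
Qed.

(** Removing the exceptional null set from [D] changes neither integral and leaves a pointwise
    comparison. *)
Lemma ae_le_integral {d : measure_display} {T : measurableType d}
    {R : realType} {mu : measure T R} {D : set T} {f g : T -> \bar R} :
  measurable D -> mu.-integrable D f -> mu.-integrable D g ->
  {ae mu, forall x, (f x <= g x)%E} ->
  (\int[mu]_(x in D) f x <= \int[mu]_(x in D) g x)%E.
Proof.
move=> mD fi gi [N [mN N0 fgN]].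
rewrite (negligible_integral mN mD fi N0) (negligible_integral mN mD gi N0).
have mDN : measurable (D `\` N) by exact: measurableD.
apply: le_integral => //; [exact: integrableS fi|exact: integrableS gi|].
move=> x; rewrite inE => -[_ Nx]; apply: contra_notT Nx => /negP fg.
exact: fgN.
Qed.

(** * Ville's maximal inequality *)

Section ville.
Context {d : measure_display} {T : measurableType d} {R : realType}.
Context {P : probability T R} {F : filtration T} {L : nat -> T -> R}.
Hypothesis smL : supermartingale P F L.
Hypothesis L_ge0 : forall t, {ae P, forall w, 0 <= L t w}.

Let adL : adapted F L. Proof. by case: smL. Qed.

Lemma integrable_supermartingale (t : nat) (A : set T) :
  measurable A -> P.-integrable A (EFin \o L t).
Proof.
by move=> mA; case: smL => _ iL _; apply: integrableS (iL t).
Qed.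

(** Over an event of [F t], [L t.+1] integrates like its conditional expectation [Z], which is a.s.
    at most [L t]. *)
Lemma supermartingale_integral_le {t : nat} {A : set T} : F t A ->
  (\int[P]_(w in A) (L t.+1 w)%:E <= \int[P]_(w in A) (L t w)%:E)%E.
Proof.
move=> FA; have mA := filtration_measurable FA.
have [_ _ /(_ t)[Z [_ iZ intZ] ZL]] := smL.
rewrite -(intZ _ FA); apply: ae_le_integral => //.
- exact: integrableS iZ.
- exact: integrable_supermartingale.
Qed.

Variable c : R.

Let A t := L t @^-1` `[c, +oo[.
(** The event that [L] has reached level [c] by time [n], inclusive. *)
Let E n := \big[setU/set0]_(t < n.+1) A t.

Let FE n : F n (E n).
Proof.
rewrite -measurable_filtrationE; apply: bigsetU_measurable => t _.
rewrite measurable_filtrationE; apply: adapted_preimage => //.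
by rewrite -ltnS.
Qed.

Let mE n : measurable (E n). Proof. exact: filtration_measurable (FE n). Qed.

Let mA t : measurable (A t).
Proof.
by apply: (@filtration_measurable _ _ F t); exact: adapted_preimage.
Qed.

Let cP_le (t : nat) (B : set T) : measurable B -> B `<=` A t ->
  (c%:E * P B <= \int[P]_(w in B) (L t w)%:E)%E.
Proof.
move=> mB BA; rewrite -integral_cst//; apply: le_integral => //.
- apply: (@integrableS _ _ _ _ setT) => //.
  exact: finite_measure_integrable_cst.
- exact: integrable_supermartingale.
- move=> w; rewrite inE => /BA; rewrite /A /= in_itv/= andbT => cL.
  by rewrite lee_fin.
Qed.

(* Optional stopping at the first passage above c: the left-hand side is at most
   the expectation of L at time n, stopped at that passage. *)
Let stopped_integral_le n :
  (c%:E * P (E n) + \int[P]_(w in ~` E n) (L n w)%:E <= 'E_P[L 0%N])%E.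
Proof.
have mEC k : measurable (~` E k) by exact: measurableC.
elim: n => [|n IH].
  have -> : ('E_P[L 0%N] = \int[P]_(w in setT) (L 0%N w)%:E)%E by rewrite unlock.
  rewrite -(setUv (E 0%N)) integral_setU //; last first.
  - by rewrite disj_set2E setICr.
  - rewrite setUv; apply/measurable_EFinP; exact: adapted_measurable_fun.
  apply: leeD => //; apply: cP_le => //.
  by rewrite /E big_ord_recl big_ord0 setU0.
apply: le_trans IH.
(* [B] is the event that the first passage happens exactly at time [n.+1]. *)
pose B := A n.+1 `\` E n.
have mB : measurable B by exact: measurableD.
have EnB : E n.+1 = E n `|` B.
  rewrite /B /E big_ord_recr /=; apply/seteqP; split=> w.
    case=> [|Aw]; first by left.
    by have [|] := pselect ((\big[setU/set0]_(t < n.+1) A t) w); [left|right].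
  by case=> [|[]]; [left|right].
have CEn : ~` E n = B `|` ~` E n.+1.
  apply/seteqP; split=> w.
    by move=> nE; case: (pselect (B w)) => Bw; [left|right; rewrite EnB => -[]].
  by case=> [[]//|]; apply: contra_not; rewrite EnB; left.
have BE0 : B `&` E n = set0 by rewrite /B setDE -setIA setICl setI0.
rewrite {1}EnB measureU //; last by rewrite setIC.
rewrite ge0_muleDr// -addeA; apply: leeD => //.
(* Not having passed by time [n] is known at time [n], so on this event [L n] may be replaced by
   [L n.+1]. *)
have FC : F n (~` E n).
  rewrite -measurable_filtrationE; apply: measurableC.
  by rewrite measurable_filtrationE.
apply: le_trans (supermartingale_integral_le FC).
rewrite [X in (_ <= \int[_]_(w in X) _)%E]CEn integral_setU //; last first.
- by rewrite disj_set2E EnB setCU setIA [B `&` _]setIC -setIA setICr setI0.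
- apply/measurable_EFinP/measurable_funTS; exact: adapted_measurable_fun.
by apply: leeD => //; apply: cP_le => // w [].
Qed.

Let crossingE : [set w | exists t, c <= L t w] = \bigcup_n E n.
Proof.
rewrite bigcup_bigsetU_bigcup; apply/seteqP; split=> w.
- by move=> [t ct]; exists t => //; rewrite /A /= in_itv/= ct.
- by move=> [t _]; rewrite /A /= in_itv/= andbT => ct; exists t.
Qed.

Lemma measurable_level_crossing : measurable [set w | exists t, c <= L t w].
Proof. by rewrite crossingE; exact: bigcupT_measurable. Qed.

Lemma ville_inequality :
  (c%:E * P [set w | exists t, (c <= L t w)%R] <= 'E_P[L 0%N])%E.
Proof.
rewrite crossingE.
have cvgE : (c%:E * P (E n))%E @[n --> \oo] --> (c%:E * P (\bigcup_n E n))%E.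
  apply: cvgeZl => //; apply: nondecreasing_cvg_mu => //.
  - exact: bigcupT_measurable.
  - by move=> m n mn; apply/subsetPset; exact: subset_bigsetU.
rewrite -(cvg_lim _ cvgE) //; apply: lime_le.
  by apply/cvg_ex; eexists; exact: cvgE.
apply: nearW => n; apply: le_trans (stopped_integral_le n).
rewrite leeDl //.
rewrite -(@integral0 _ _ _ P (~` E n)); apply: ae_le_integral => //.
- exact: measurableC.
- exact: integrable0.
- exact/integrable_supermartingale/measurableC.
- by apply: filterS (L_ge0 n) => w; rewrite lee_fin.
Qed.

End ville.

(** * Crossing of a line by a sub-Gaussian process *)

Lemma measurable_le_set {d : measure_display} {T : measurableType d}
    {R : realType} {X Y : T -> R} :
  measurable_fun setT X -> measurable_fun setT Y ->
  measurable [set w | X w <= Y w].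
Proof.
move=> mX mY.
have := measurable_fun_ler mX mY measurableT (_ : measurable [set true]).
by rewrite setTI; apply.
Qed.

Lemma measurable_exists_le {d : measure_display} {T : measurableType d}
    {R : realType} {X Y : nat -> T -> R} :
  (forall t, measurable_fun setT (X t)) ->
  (forall t, measurable_fun setT (Y t)) ->
  measurable [set w | exists t, X t w <= Y t w].
Proof.
move=> mX mY.
rewrite [X in measurable X](_ : _ = \bigcup_t [set w | X t w <= Y t w]).
  by apply: bigcupT_measurable => t; exact: measurable_le_set.
by apply/seteqP; split=> [w [t ?]|w [t _ ?]]; exists t.
Qed.

Lemma measurable_line_crossing {d : measure_display} {T : measurableType d}
    {R : realType} {F : filtration T} {S V : nat -> T -> R} (a b : R) :
  adapted F S -> adapted F V ->
  measurable [set w | exists t, a + b * V t w <= S t w].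
Proof.
move=> aS aV.
apply: measurable_exists_le => t; last exact: adapted_measurable_fun.
apply: measurable_funD => //; apply: measurable_funM => //.
exact: adapted_measurable_fun.
Qed.

Lemma sub_gaussian_line_crossing {d : measure_display} {T : measurableType d}
    {R : realType} {P : probability T R} {F : filtration T} {l0 : R}
    {S V : nat -> T -> R} (a b : R) :
  sub_psi P F +oo%E (@psi_N R) l0 S V -> 0 <= b ->
  (P [set w | exists t, (a + b * V t w <= S t w)%R] <=
     (l0 * expR (- (2 * a * b)))%:E)%E.
Proof.
move=> [[aS aV] _ _ subS] b_ge0.
(* On S >= a + bV the exponent is at least lambda a + (lambda b - lambda^2/2) V; lambda = 2b cancels
   the coefficient of V. *)
have [|L [smL L0 SL]] := subS (2 * b) _ (ltry _); first by rewrite mulr_ge0.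
have mC := measurable_line_crossing a b aS aV.
have L_ge0 t : {ae P, forall w, 0 <= L t w}.
  by apply: filterS (SL t) => w; apply: le_trans; exact: expR_ge0.
(* The crossing time depends on [w], so a single null set must serve all times. *)
have [N [mN N0 SLN]] := ae_foralln SL.
set c := expR (2 * a * b).
have mE := measurable_level_crossing smL c.
rewrite expRN EFinM lee_pdivlMr ?expR_gt0 // muleC.
apply: le_trans L0; apply: le_trans (ville_inequality smL L_ge0 c).
apply: lee_wpmul2l; first by rewrite lee_fin expR_ge0.
(* The line crossing lies in the level crossing of [L] only up to [N], which is adjoined at no
   cost. *)
rewrite -(measureU0 mE mN N0); apply: le_measure; rewrite ?inE //.
  exact: measurableU.
move=> w [t abS]; have [Nw|Nw] := pselect (N w); [by right|left].
exists t; have := contra_notP (SLN w) Nw => /(_ t); apply: le_trans.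
rewrite ler_expR /psi_N.
have -> : (2 * b) ^+ 2 / 2 * V t w = 2 * b * (b * V t w) by field.
by rewrite -mulrBr -mulrA [a * b]mulrC mulrA ler_wpM2l ?mulr_ge0 // lerBrDr.
Qed.

(** * Chords and monotonicity of nonnegative concave functions *)

Section concave.
Context {R : realType} {g : R -> R}.
Hypothesis g_ge0 : forall v, 0 <= v -> 0 <= g v.
Hypothesis g_concave : strictly_concave_on [set v : R | 0 <= v] g.

Lemma concave_chord_le {x y v : R} : 0 <= x -> x < y -> x <= v -> v <= y ->
  (y * g x - x * g y) / (y - x) + (g y - g x) / (y - x) * v <= g v.
Proof.
move=> x0 xy xv vy; have yx : 0 < y - x by rewrite subr_gt0.
have y0 : 0 <= y by rewrite (le_trans x0) ?ltW.
have -> : (y * g x - x * g y) / (y - x) + (g y - g x) / (y - x) * v =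
    (y - v) / (y - x) * g x + (1 - (y - v) / (y - x)) * g y.
  by field; rewrite gt_eqF.
(* Strict concavity speaks only of weights strictly between 0 and 1, so the endpoints are settled
   separately. *)
have [->|xv'] := eqVneq v x.
  by rewrite divff ?gt_eqF// subrr mul1r mul0r addr0.
have [->|vy'] := eqVneq v y.
  by rewrite subrr mul0r subr0 mul1r mul0r add0r.
have {xv xv'} xv : x < v by rewrite lt_neqAle eq_sym xv'.
have {vy vy'} vy : v < y by rewrite lt_neqAle vy'.
have ev : v = (y - v) / (y - x) * x + (1 - (y - v) / (y - x)) * y.
  by field; rewrite gt_eqF.
rewrite [X in _ <= g X]ev; apply/ltW/g_concave => //; first by rewrite lt_eqF.
- by rewrite divr_gt0// subr_gt0.
- by rewrite ltr_pdivrMr// mul1r; lra.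
Qed.

(* If g decreased somewhere, its chords would force it below 0 far to the right. *)
Lemma nonneg_concave_nondecreasing {x y : R} : 0 <= x -> x <= y -> g x <= g y.
Proof.
move=> x0; rewrite le_eqVlt => /predU1P[->//|xy].
rewrite leNgt; apply/negP => gyx.
have D : 0 < g x - g y by rewrite subr_gt0.
have gy0 : 0 <= g y by apply: g_ge0; lra.
(* The line through the points at [x] and [y] vanishes at distance (y - x) g(y) / (g(x) - g(y))
   beyond [y]; adding 1 makes it negative. *)
pose s := (y - x) * g y / (g x - g y) + 1.
have s0 : 0 < s by rewrite ltr_wpDl// divr_ge0 ?mulr_ge0//; lra.
have := @concave_chord_le x (y + s) y x0 ltac:(lra) ltac:(lra) ltac:(lra).
rewrite [_ / _ * y]mulrAC -mulrDl ler_pdivrMr; last lra.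
have gz0 : 0 <= g (y + s) by apply: g_ge0; lra.
have : s * (g x - g y) = (y - x) * g y + (g x - g y).
  by rewrite /s; field; rewrite gt_eqF.
nra.
Qed.

End concave.

(** * The geometric grid of powers of [eta] *)

Lemma geometric_bracket {R : realType} (eta m : R) (K : nat) :
  1 <= eta -> 1 <= m -> m <= eta ^+ K ->
  exists2 k, (k <= K)%N & eta ^+ k <= m <= eta ^+ k.+1.
Proof.
move=> eta1 m1 mK.
have mK1 : m <= eta ^+ K.+1 by rewrite (le_trans mK)// ler_weXn2l.
(* The least such index works: minimality gives the lower bound for positive k, and [1 <= m] gives
   it for k = 0. *)
have [k mk kmin] := ex_minnP (ex_intro (fun n => m <= eta ^+ n.+1) K mK1).
exists k; first exact: kmin; rewrite mk andbT.
case: k kmin {mk} => [|k] kmin; first by rewrite expr0.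
by rewrite leNgt; apply/negP => /ltW /kmin; rewrite ltnn.
Qed.

(** Logarithms reduce this to q <= ceil(q) with q = ln v / ln eta; as q >= 0, the absolute value is
    harmless. *)
Lemma le_exp_ceil_log {R : realType} {eta v : R} : 1 < eta -> 1 < v ->
  v <= eta ^+ `|Num.ceil (ln v / ln eta)|%N.
Proof.
move=> eta1 v1; have v0 : 0 < v by lra.
have eta0 : 0 < eta by lra.
have q0 : 0 <= ln v / ln eta by rewrite divr_ge0 ?ln_ge0 ?ltW.
rewrite -ler_ln ?posrE ?exprn_gt0 // lnXn // -mulr_natr mulrC.
rewrite -ler_pdivrMr ?ln_gt0 // natr_absz ger0_norm ?ceil_ge //.
by rewrite ceil_ge0 (lt_le_trans _ q0).
Qed.

(** * Measurability of the crossing and the union bound *)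

Theorem theorem3 (R : realType) (l0 : R) (hl0 : 1 <= l0) (g : R -> R)
    (g_ge0 : forall v : R, 0 <= v -> 0 <= g v)
    (g_concave : strictly_concave_on [set v : R | 0 <= v] g)
    (v_max : R) (hv_max : 1 < v_max) :
  sub_gaussian_uniform_boundary l0 (truncated_boundary g v_max)
    (l0 * inf [set crossing_sum g v_max eta | eta in [set eta : R | 1 < eta]]).
Proof.
move=> d T P F S V subS; have [[aS aV] _ _ _] := subS.
pose h v := g (Num.max 1 v).
(* Monotonicity makes [h] Borel, which is what makes the crossing an event. *)
have h_ndecr : {homo h : v w / v <= w}.
  move=> v w vw; apply: (nonneg_concave_nondecreasing g_ge0 g_concave).
    by rewrite le_max ler01.
  by rewrite ge_max !le_max lexx vw orbT.
have mC : measurable (crossing (truncated_boundary g v_max) S V).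
  rewrite [X in measurable X](_ : _ = \bigcup_(t in [set t | (1 <= t)%N])
      ((V t @^-1` `]-oo, v_max]) `&` [set w | (h \o V t) w <= S t w])).
    apply: bigcup_measurable => t _; apply: measurableI.
      by rewrite -[X in measurable X]setTI; exact: (adapted_measurable_fun t aV).
    apply: measurable_le_set; last exact: adapted_measurable_fun.
    apply: measurableT_comp; last exact: adapted_measurable_fun.
    exact: nondecreasing_measurable.
  apply/seteqP; split=> w [t].
    rewrite /truncated_boundary; case: ifPn => [Vv [t1 hS]|_ []//].
    by exists t => //; split=> //=; rewrite in_itv/=.
  move=> t1 [/=]; rewrite in_itv/= => Vv hS; exists t; split => //.
  by rewrite /truncated_boundary Vv.
split=> //.
rewrite -[X in (X <= _)%E]fineK ?fin_num_measure // lee_fin.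
rewrite -ler_pdivrMl; last lra.
(* A lower bound passes to [inf] only for a nonempty set; eta = 2 is a witness. *)
apply: lb_le_inf; first by exists (crossing_sum g v_max 2), 2 => //=; lra.
move=> _ [eta /= eta1 <-]; rewrite ler_pdivrMl; last lra.
rewrite -lee_fin fineK ?fin_num_measure // /crossing_sum big_mkord.
set K := `|_|%N.
have vK : v_max <= eta ^+ K := le_exp_ceil_log eta1 hv_max.
have etaX k : 0 < eta ^+ k by apply: exprn_gt0; lra.
have etaXS k : eta ^+ k < eta ^+ k.+1 by rewrite ltr_eXn2l.
have dX k : eta ^+ k.+1 - eta ^+ k = eta ^+ k * (eta - 1) by rewrite exprS; ring.
pose b k := (g (eta ^+ k.+1) - g (eta ^+ k)) / (eta ^+ k.+1 - eta ^+ k).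
pose a k := (eta ^+ k.+1 * g (eta ^+ k) - eta ^+ k * g (eta ^+ k.+1))
            / (eta ^+ k.+1 - eta ^+ k).
have b_ge0 k : 0 <= b k.
  rewrite divr_ge0 ?subr_ge0 ?(ltW (etaXS k)) //.
  by apply: (nonneg_concave_nondecreasing g_ge0 g_concave); rewrite ?ltW.
pose C k := [set w | exists t, a k + b k * V t w <= S t w].
have mCk k : measurable (C k) by exact: measurable_line_crossing aS aV.
have sub : crossing (truncated_boundary g v_max) S V `<=`
    \big[setU/set0]_(k < K.+1) C k.
  rewrite -bigcup_mkord => w [t [_]]; rewrite /truncated_boundary.
  case: ifPn => // Vv; rewrite lee_fin => gS.
  (* Bracketing max(1, V) rather than V sends the values below 1 to the first intervals of the
     grid. *)
  have [|||k kK /andP[km mk]] := @geometric_bracket _ eta (Num.max 1 (V t w)) K.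
  - exact: ltW.
  - by rewrite le_max lexx.
  - by rewrite (le_trans _ vK)// ge_max Vv ltW.
  exists k => //; exists t; apply: le_trans gS.
  apply: le_trans (concave_chord_le g_concave (ltW (etaX k)) (etaXS k) km mk).
  (* As the slope is nonnegative, the line at V is no higher than at max(1, V). *)
  by rewrite lerD2l ler_wpM2l // le_max lexx orbT.
apply: (@le_trans _ _ (P (\big[setU/set0]_(k < K.+1) C k))).
  by apply: le_measure; rewrite ?inE //; exact: bigsetU_measurable.
apply: le_trans; first exact: Boole_inequality.
rewrite mulr_sumr -sumEFin; apply: lee_sum => k _.
have := sub_gaussian_line_crossing (a k) (b k) subS (b_ge0 k).
congr (_ <= (_ * expR (- _))%:E)%E.
(* The intercept simplifies to (eta g(eta^k) - g(eta^(k+1))) / (eta - 1), so 2ab is the exponent in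
   the sum. *)
rewrite /a /b dX exprS; field.
by rewrite !gt_eqF //= subr_gt0.
Qed.
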